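(* Let $k\ge0$ be an integer and let $r\ge 6$. Then for every $x\in B_{r-3}\setminus B_3$ and every rotor configuration $\rho:\mathbb{Z}^2\to\{\mathcal{H},\mathcal{V}\}$, $$\frac{1}{58\cdot 2^{58}}\;\le\;\frac{p_{even}(\rho,x)}{p_{odd}(\rho,x)}\;\le\;58\cdot 2^{58}.$$
   Context: For $r\ge1$, $B_r=\{x\in\mathbb{Z}^2:|x|<r\}$ (Euclidean norm) and $\partial B_r=\{x\in\mathbb{Z}^2\setminus B_r: x \text{ has a nearest neighbor in } B_r\}$. A rotor configuration is here regarded as an assignment of a label $\mathcal{H}$ or $\mathcal{V}$ to each vertex of $\mathbb{Z}^2$. $(Y_t,\zeta_t)_{t\ge0}$ is the single-walker $\mathcal{H}$–$\mathcal{V}$ walk on $\mathbb{Z}^2$ with $q=1$, frozen on $\partial B_r$: $Y_0=(0,0)$, $\zeta_0=\rho$; at each step, if the walker's current location $y=Y_t$ is in $\partial B_r$ nothing changes; otherwise the label at $y$ is flipped ($\mathcal{H}\leftrightarrow\mathcal{V}$) to give $\zeta_{t+1}$, and then the walker moves to $y\pm(1,0)$ with probability $\frac12$ each if the new label at $y$ is $\mathcal{H}$, and to $y\pm(0,1)$ with probability $\frac12$ each if the new label at $y$ is $\mathcal{V}$, independently of the past. $R_{t,r}$ is the number of returns to the origin up to time $t$: the number of $s\in\{1,\dots,t\}$ with $Y_{s-1}\ne(0,0)$, $Y_s=(0,0)$. The stopping time is $\tau=\tau_{k,r}(\rho)=\min\{t\ge0: R_{t,r}=k \text{ or } Y_t\in\partial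 B_r\}$, which is a.s. finite. $p_{even}(\rho,x)=\mathbb{P}\big[\,|\{t\in\{1,\dots,\tau\}:Y_t=x\}|\in\{2,4,6,\dots\}\big]$ and $p_{odd}(\rho,x)=\mathbb{P}\big[\,|\{t\in\{1,\dots,\tau\}:Y_t=x\}|\in\{1,3,5,\dots\}\big]$, for the walk with fixed initial labels $\rho$.
   Formalization: For k = 0 the walk stops at time 0, so p_even = p_odd = 0 and the ratio is the undefined 0/0; the formal theorem states that both probabilities vanish for k = 0 and asserts the two ratio bounds for k ≥ 1 only. *)

(* Defs.v *)
From HB Require Import structures.
From mathcomp Require Import all_boot all_order all_algebra.
From mathcomp Require Import all_classical all_reals all_analysis.
Set Implicit Arguments.
Unset Strict Implicit.
Unset Printing Implicit Defensive.
Import Order.TTheory GRing.Theory Num.Theory.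
Local Open Scope classical_set_scope.
Local Open Scope ring_scope.

Definition Z2 := (int * int)%type.

Definition origin : Z2 := (0, 0).
Definition e1 : Z2 := (1, 0).
Definition e2 : Z2 := (0, 1).

Definition horizontal_nbrs (y : Z2) : seq Z2 := [:: y + e1; y - e1].
Definition vertical_nbrs (y : Z2) : seq Z2 := [:: y + e2; y - e2].
Definition nbrs (y : Z2) : seq Z2 := horizontal_nbrs y ++ vertical_nbrs y.

Definition enorm (R : realType) (x : Z2) : R :=
  Num.sqrt (x.1%:~R ^+ 2 + x.2%:~R ^+ 2).

Definition in_ball (R : realType) (r : R) (x : Z2) : bool := enorm R x < r.

Definition in_bdry (R : realType) (r : R) (x : Z2) : bool :=
  ~~ in_ball r x && has (in_ball r) (nbrs x).

Inductive label := LabH | LabV.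

Definition flip (l : label) : label :=
  match l with LabH => LabV | LabV => LabH end.

Definition config := Z2 -> label.

Definition flip_at (y : Z2) (eta : config) : config :=
  fun z => if z == y then flip (eta z) else eta z.

Definition update (R : realType) (r : R) (y : Z2) (eta : config) : config :=
  if in_bdry r y then eta else flip_at y eta.

(* Probability of moving from y to y', where eta is the configuration after
   the update at y. *)
Definition step_prob (R : realType) (r : R) (eta : config) (y y' : Z2) : R :=
  if in_bdry r y then (y' == y)%:R
  else match eta y with
       | LabH => if y' \in horizontal_nbrs y then 2^-1 else 0
       | LabV => if y' \in vertical_nbrs y then 2^-1 else 0
       end.

(* (Y, zeta) is a single-walker H-V walk with q = 1 started from the origin
   with labels rho and frozen on the boundary of B_r.  Since zeta is a
   function of rho and of the path of Y, conditioning on Y_0, ..., Y_t is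
   conditioning on the whole past; the last field is the conditional law of
   Y_(t+1) in multiplied-out form, so that it also makes sense for pasts of
   probability zero. *)
Record HV_walk (R : realType) (d : measure_display) (Omega : measurableType d)
    (P : probability Omega R) (r : R) (rho : config)
    (Y : nat -> Omega -> Z2) (zeta : nat -> Omega -> config) : Prop := {
  HV_measurable : forall t y, measurable [set w | Y t w = y];
  HV_start : forall w, Y 0%N w = origin;
  HV_labels0 : forall w, zeta 0%N w = rho;
  HV_labelsS : forall t w, zeta t.+1 w = update r (Y t w) (zeta t w);
  HV_move : forall t (h : nat -> Z2) (eta : config) (y : Z2),
    let past := [set w | (forall s, (s <= t)%N -> Y s w = h s) /\
                         zeta t.+1 w = eta] in
    P (past `&` [set w | Y t.+1 w = y]) =
    (P past * (step_prob r eta (h t) y)%:E)%E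
}.

Definition returns (y : nat -> Z2) (t : nat) : nat :=
  count (fun s => (y s.-1 != origin) && (y s == origin)) (iota 1 t).

Definition stopped (R : realType) (r : R) (k : nat) (y : nat -> Z2) (t : nat)
    : bool :=
  (returns y t == k) || in_bdry r (y t).

Definition is_tau (R : realType) (r : R) (k : nat) (y : nat -> Z2) (n : nat)
    : Prop :=
  stopped r k y n /\ forall m, (m < n)%N -> ~~ stopped r k y m.

Definition visits (y : nat -> Z2) (x : Z2) (n : nat) : nat :=
  count (fun t => y t == x) (iota 1 n).

(* Trajectories with tau infinite form a null set and are in neither of the
   two events below. *)
Definition p_even (R : realType) (d : measure_display)
    (Omega : measurableType d) (P : probability Omega R) (r : R) (k : nat)
    (Y : nat -> Omega -> Z2) (x : Z2) : R :=
  fine (P [set w | exists n, is_tau r k (Y ^~ w) n /\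
                             (0 < visits (Y ^~ w) x n)%N /\
                             ~~ odd (visits (Y ^~ w) x n)]).

Definition p_odd (R : realType) (d : measure_display)
    (Omega : measurableType d) (P : probability Omega R) (r : R) (k : nat)
    (Y : nat -> Omega -> Z2) (x : Z2) : R :=
  fine (P [set w | exists n, is_tau r k (Y ^~ w) n /\
                             odd (visits (Y ^~ w) x n)]).

(* Main.v *)
Require Import Defs.
From HB Require Import structures.
From mathcomp Require Import all_boot all_order all_algebra.
From mathcomp Require Import all_classical all_reals all_analysis.
From mathcomp Require Import zify lra.
Set Implicit Arguments.
Unset Strict Implicit.
Unset Printing Implicit Defensive.
Import Order.TTheory GRing.Theory Num.Theory.
Local Open Scope ring_scope.

(** The law of the walk stopped at tau gives weight 2^-n to every admissible
    path of length n, so it suffices to transform admissible paths that visit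
    x into admissible paths with the other parity of visits, while changing
    the length by a bounded amount and remaining injective up to a bounded
    multiplicity.

    Let B be the three by three box centred at x.  The hypotheses on x put B
    inside the ball and away from the origin, so the stopped path ends outside
    B.  Cut it at its last departure from B, from a site y to a site z outside
    B.  Nothing that happens afterwards depends on the labels inside B.  Just
    before this departure, insert a loop from y to y inside B that visits x an
    odd number of times and leaves y an even number of times: the label at y
    is as before, the walker leaves to z, and the rest of the path remains
    admissible.  Such a loop of length at most 14 exists for all labels in B;
    there are finitely many cases, and they are decided by computation
    ([box_loop]).  The result is [detour].

    The inserted loop ends at the last time the new path is in B, so the old
    path is determined by the new one and the length of the loop
    ([inserts_inj]).  There are at most 15 lengths, each costing a factor of at
    most 2^14.  Hence each parity has probability at most 15 * 2^14 times that
    of the other ([parity_le]), and 15 * 2^14 <= 58 * 2^58.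

    The quotient also has to be defined, so some path must visit x before it
    stops.  A walker in a three by three box can always be steered to the
    centre of that box, and a chain of overlapping boxes that miss the origin
    leads first to x and then out of the ball ([escape]). *)

(** * Paths and labels *)

Lemma flipK : involutive flip. Proof. by case. Qed.

Definition isH (l : label) : bool := if l is LabH then true else false.

Lemma isH_inj : injective isH. Proof. by case; case. Qed.

Lemma isH_flip l : isH (flip l) = ~~ isH l. Proof. by case: l. Qed.

(** [true] stands for the horizontal axis, in accordance with [isH]. *)
Definition axis_nbrs (h : bool) (y : Z2) : seq Z2 :=
  if h then horizontal_nbrs y else vertical_nbrs y.

(** [l] lists the sites departed from, one flip for each departure.  The labels
    along a path thus depend only on the number of departures from each site,
    which makes comparing a path before and after surgery a matter of
    counting. *)
Definition relabel (eta : config) (l : seq Z2) : config :=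
  fun z => iter (count_mem z l) flip (eta z).

(** There is no freezing here: probabilities are computed only for paths that
    are cut at their first boundary site. *)
Fixpoint walk (eta : config) (y : Z2) (s : seq Z2) : bool :=
  if s is z :: s' then
    (z \in axis_nbrs (isH (flip (eta y))) y) && walk (flip_at y eta) z s'
  else true.

Lemma relabel_cat eta l1 l2 :
  relabel eta (l1 ++ l2) = relabel (relabel eta l1) l2.
Proof. by apply/funext => z; rewrite /relabel count_cat addnC iterD. Qed.

Lemma flip_atE y eta : flip_at y eta = relabel eta [:: y].
Proof.
apply/funext => z; rewrite /relabel /flip_at /= addn0 eq_sym.
by case: (y == z).
Qed.

Lemma relabel_notin eta l z : z \notin l -> relabel eta l z = eta z.
Proof. by move=> /count_memPn zl; rewrite /relabel zl. Qed.

Lemma relabel_oddE eta l z :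
  relabel eta l z = if odd (count_mem z l) then flip (eta z) else eta z.
Proof.
rewrite /relabel; elim: (count_mem z l) => //= n ->.
by case: (odd n) => //=; rewrite flipK.
Qed.

Lemma walk_cat eta y s1 s2 :
  walk eta y (s1 ++ s2) =
  walk eta y s1 && walk (relabel eta (belast y s1)) (last y s1) s2.
Proof.
elim: s1 eta y => [|z s1 IH] eta y //=.
by rewrite IH andbA flip_atE -relabel_cat.
Qed.

Lemma eq_walk eta eta' y s :
  {in belast y s, eta =1 eta'} -> walk eta y s = walk eta' y s.
Proof.
elim: s eta eta' y => [|z s IH] eta eta' y //= ee.
rewrite (ee y) ?mem_head//; congr (_ && _); apply: IH => w ws.
by rewrite /flip_at (ee w) // in_cons ws orbT.
Qed.

(** * Finite checks in a three by three box *)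

Definition cells : seq (nat * nat) := [seq (a, b) | a <- iota 0 3, b <- iota 0 3].

Definition cell_site (x : Z2) (c : nat * nat) : Z2 :=
  x + (c.1%:Z - 1, c.2%:Z - 1).

Definition box (x : Z2) : seq Z2 := [seq cell_site x c | c <- cells].

Definition centre : nat * nat := (1, 1)%N.

Definition cell_index (c : nat * nat) : nat := (3 * c.1 + c.2)%N.

Definition line_nbrs (a : nat) : seq nat :=
  if a is 1%N then [:: 0; 2]%N else [:: 1%N].

Definition cell_nbrs (h : bool) (c : nat * nat) : seq (nat * nat) :=
  if h then [seq (a, c.2) | a <- line_nbrs c.1]
  else [seq (c.1, b) | b <- line_nbrs c.2].

(** Is a configuration satisfying [goal] reachable in at most [n] steps inside
    the box?  [l] holds the current labels, [true] for horizontal.  The choices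
    are explored by nested conditionals rather than by a boolean disjunction,
    which a call by value evaluation would explore on both sides. *)
Fixpoint search (goal : nat * nat -> seq bool -> bool) (n : nat)
    (c : nat * nat) (l : seq bool) : bool :=
  if goal c l then true else
  if n is n'.+1 then
    let h := ~~ nth true l (cell_index c) in
    let l' := set_nth true l (cell_index c) h in
    match cell_nbrs h c with
    | [:: c1] => search goal n' c1 l'
    | [:: c1, c2 & _] =>
        if search goal n' c1 l' then true else search goal n' c2 l'
    | [::] => false
    end
  else false.

Fixpoint bitseqs (n : nat) : seq (seq bool) :=
  if n is n'.+1 then
    map (cons true) (bitseqs n') ++ map (cons false) (bitseqs n')
  else [:: [::]].

Lemma mem_bitseqs l : l \in bitseqs (size l).
Proof.
elim: l => //= b l IH; rewrite mem_cat; apply/orP.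
by case: b; [left|right]; apply: map_f.
Qed.

Definition box_labels (x : Z2) (eta : config) : seq bool :=
  [seq isH (eta (cell_site x c)) | c <- cells].

Lemma cell_site_inj x : injective (cell_site x).
Proof.
move=> [a b] [a' b'] /addrI [] /addIr [->] /addIr [->] //.
Qed.

Lemma cell_indexE c : c \in cells -> cell_index c = index c cells.
Proof.
move=> cc; apply/eqP.
by have /allP /(_ c cc) : all (fun c => cell_index c == index c cells) cells.
Qed.

Lemma size_box_labels x eta : size (box_labels x eta) = 9%N.
Proof. by rewrite size_map. Qed.

Lemma nth_box_labels x eta c : c \in cells ->
  nth true (box_labels x eta) (cell_index c) = isH (eta (cell_site x c)).
Proof.
move=> cc; rewrite cell_indexE// (nth_map (0,0)%N) ?index_mem//.
by rewrite nth_index.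
Qed.

Lemma box_labels_flip_at x eta c : c \in cells ->
  box_labels x (flip_at (cell_site x c) eta) =
  set_nth true (box_labels x eta) (cell_index c)
    (~~ nth true (box_labels x eta) (cell_index c)).
Proof.
move=> cc; have ic : (cell_index c < 9)%N by rewrite cell_indexE// index_mem.
apply: (@eq_from_nth _ true).
  by rewrite size_set_nth !size_box_labels; apply/esym/maxn_idPr.
move=> i; rewrite size_box_labels => i9.
rewrite nth_set_nth /= nth_box_labels // /box_labels.
rewrite !(nth_map (0, 0)%N) //; set ci := nth _ cells i.
have cic : ci \in cells by rewrite mem_nth.
have iE : i = cell_index ci by rewrite cell_indexE// index_uniq.
rewrite /flip_at (inj_eq (@cell_site_inj x)).
have -> : (i == cell_index c) = (ci == c).
  apply/eqP/eqP => [|<-//]; rewrite iE !cell_indexE // => e.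
  by rewrite -(nth_index (0,0)%N cic) e nth_index.
by case: eqP => [->|_] //; rewrite isH_flip.
Qed.

Lemma cell_nbrs_cells h c : c \in cells -> {subset cell_nbrs h c <= cells}.
Proof.
move=> cc; apply/allP.
have : all (fun c => all (fun h => all (mem cells) (cell_nbrs h c))
  [:: true; false]) cells by [].
by move=> /allP /(_ c cc) /allP; apply; case: h.
Qed.

Lemma cell_nbrs_axis x h c c' : c \in cells -> c' \in cell_nbrs h c ->
  cell_site x c' \in axis_nbrs h (cell_site x c).
Proof.
move=> cc cc'.
have /allP/(_ _ cc)/allP/(_ h) : all (fun c => all (fun h => all (fun c' =>
    cell_site 0 c' \in axis_nbrs h (cell_site 0 c)) (cell_nbrs h c))
  [:: true; false]) cells by [].
have -> : h \in [:: true; false] by case: h {cc'}.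
move=> /(_ isT) /allP /(_ _ cc').
rewrite /cell_site !add0r /axis_nbrs.
by case: h {cc'}; rewrite !inE -!addrA !(inj_eq (@addrI _ _)).
Qed.

(** Turns the geometric condition of leaving the box along the axis [h] into one
    that the finite check can test. *)
Lemma cell_exit x h c z : c \in cells ->
  z \in axis_nbrs h (cell_site x c) -> z \notin box x ->
  size (cell_nbrs h c) = 1%N.
Proof.
move=> cc zc zx.
suff : size (cell_nbrs h c) != 2%N.
  by case: c {cc zc} => [[|[|a]] [|[|b]]]; case: h.
apply: contraNN zx => s2.
have /allP/(_ _ cc)/allP/(_ h) : all (fun c => all (fun h =>
    (size (cell_nbrs h c) == 2%N) ==>
    all (mem (box 0)) (axis_nbrs h (cell_site 0 c)))
  [:: true; false]) cells by [].
have -> : h \in [:: true; false] by case: h {zc s2}.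
move=> /(_ isT); rewrite s2 /= => /allP /(_ (z - x)).
have -> : z - x \in axis_nbrs h (cell_site 0 c).
  move: zc; rewrite /axis_nbrs /cell_site add0r.
  by case: h {s2}; rewrite !inE !(subr_eq z) -!(addrC x) -!addrA.
move=> /(_ isT) /mapP [c' c'c e]; apply/mapP; exists c' => //.
by rewrite /cell_site -[LHS](subrK x) addrC e /cell_site add0r.
Qed.

Lemma search_sound goal n c x eta : c \in cells ->
  search goal n c (box_labels x eta) ->
  exists s, [/\ (size s <= n)%N, {subset s <= box x},
    walk eta (cell_site x c) s &
    exists2 c', c' \in cells & last (cell_site x c) s = cell_site x c' /\
      goal c' (box_labels x (relabel eta (belast (cell_site x c) s)))].
Proof.
elim: n c eta => [|n IH] c eta cc /=.
  by case: ifP => // g _; exists [::]; split => //; exists c.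
case: ifP => [g _|_]; first by exists [::]; split => //; exists c.
rewrite -box_labels_flip_at // nth_box_labels // -isH_flip.
set h := isH _; set eta' := flip_at _ _ => H.
have {H} [c1 c1c H] : exists2 c1, c1 \in cell_nbrs h c &
    search goal n c1 (box_labels x eta').
  move: H; case: (cell_nbrs h c) => [|c1 [|c2 t]] // H.
    by exists c1 => //; rewrite mem_head.
  move: H; case: ifP => H1 H2; first by exists c1; rewrite ?mem_head.
  by exists c2 => //; rewrite !inE eqxx orbT.
have c1cells := cell_nbrs_cells cc c1c.
have [s [sn sx sw [c' c'c [lc gc]]]] := IH c1 eta' c1cells H.
exists (cell_site x c1 :: s); split => //=.
- move=> z; rewrite inE => /predU1P[->|]; last exact: sx.
  by apply/mapP; exists c1.
- by rewrite sw andbT; apply: cell_nbrs_axis.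
- exists c' => //; split => //.
  by move: gc; rewrite /eta' flip_atE -relabel_cat.
Qed.

Definition at_centre (c : nat * nat) (l : seq bool) : bool := c == centre.

(** Six steps is the least sufficient number, found by breadth first search. *)
Lemma box_centre_check :
  all (fun l => all (fun c => search at_centre 6 c l) cells) (bitseqs 9).
Proof. by vm_compute. Qed.

(** The walker is back at [y] with the required labels at [y] and at the
    centre; each departure from a site flips its label, so the labels record
    the parity of the number of departures. *)
Definition loop_closed (y : nat * nat) (hy hx : bool)
    (c : nat * nat) (l : seq bool) : bool :=
  if c == y then
    (nth true l (cell_index y) == hy) && (nth true l (cell_index centre) == hx)
  else false.

(** The condition on [size] says that the next departure from [y] can leave the
    box; in particular [y] is not the centre.  Fourteen steps is the least
    sufficient number, found by breadth first search. *)
Lemma box_loop_check :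
  all (fun l => all (fun y =>
      if size (cell_nbrs (~~ nth true l (cell_index y)) y) == 1%N then
        search (loop_closed y (nth true l (cell_index y))
                  (~~ nth true l (cell_index centre))) 14 y l
      else true) cells) (bitseqs 9).
Proof. by vm_compute. Qed.

Lemma cell_site_centre x : cell_site x centre = x.
Proof. by rewrite /cell_site /= addr0. Qed.

Lemma box_reach_centre x y eta : y \in box x ->
  exists s, [/\ {subset s <= box x}, walk eta y s & last y s = x].
Proof.
move=> /mapP [c cc ->].
have /allP/(_ (box_labels x eta)) := box_centre_check.
have -> : box_labels x eta \in bitseqs 9.
  by rewrite -(size_box_labels x eta) mem_bitseqs.
move=> /(_ isT)/allP/(_ _ cc) /(search_sound cc).
move=> [s [_ sx sw [c' _ [lc /eqP c'E]]]]; exists s; split => //.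
by rewrite lc c'E cell_site_centre.
Qed.

(** To be inserted just before a departure from [y] out of the box: the loop
    restores the label at [y], so that the departure to [z] is still possible,
    and changes the parity of the visits to the centre. *)
Lemma box_loop x y z eta : y \in box x -> z \notin box x ->
  z \in axis_nbrs (isH (flip (eta y))) y ->
  exists s, [/\ (size s <= 14)%N, {subset s <= box x}, walk eta y s,
    last y s = y &
    relabel eta (belast y s) y = eta y /\ odd (count_mem x s)].
Proof.
move=> /mapP [c cc ->] zx zc.
have s1 := cell_exit cc zc zx.
have /allP/(_ (box_labels x eta)) := box_loop_check.
have -> : box_labels x eta \in bitseqs 9.
  by rewrite -(size_box_labels x eta) mem_bitseqs.
move=> /(_ isT)/allP/(_ _ cc).
rewrite nth_box_labels// -isH_flip s1 eqxx => /(search_sound cc).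
move=> [s [sn sx sw [c' c'c [lc]]]].
rewrite /loop_closed; case: eqP => // c'E; rewrite {c'}c'E in lc c'c *.
rewrite !nth_box_labels// cell_site_centre => /andP[/eqP /isH_inj yE].
rewrite -isH_flip => /eqP /isH_inj xE.
exists s; split => //; split => //.
have -> : count_mem x s = count_mem x (belast (cell_site x c) s).
  (* The loop starts and ends at the same site, so visits and departures
     are equally many. *)
  have := congr1 (count_mem x) (lastI (cell_site x c) s).
  rewrite -cats1 count_cat lc /= addn0 addnC.
  by move=> /addIn.
move: xE; rewrite relabel_oddE.
by case: ifP => //; case: (eta x).
Qed.

(** * Boxes and balls *)

Lemma boxP (x z : Z2) :
  reflect (`|z.1 - x.1| <= 1 /\ `|z.2 - x.2| <= 1) (z \in box x).
Proof.
apply: (iffP idP) => [/mapP [[a b] abc ->] /=|].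
  have /allP/(_ _ abc) : all (fun c => (c.1 < 3) && (c.2 < 3))%N cells by [].
  by case/andP => /= ? ?; split; lia.
case: z x => [z1 z2] [x1 x2] /= [h1 h2].
have tri : forall p : int, `|p| <= 1 ->
  exists2 a, a \in iota 0 3 & p = a%:Z - 1.
  move=> p hp; exists (absz (p + 1)); last by lia.
  by rewrite mem_iota; lia.
have [a a3 ea] := tri _ h1; have [b b3 eb] := tri _ h2.
apply/mapP; exists (a, b); first by apply/allpairsP; exists (a, b).
by rewrite /cell_site /= -ea -eb; congr pair => /=; lia.
Qed.

Lemma in_ballE (R : realType) (r : R) (z : Z2) : 0 < r ->
  in_ball r z = (z.1%:~R ^+ 2 + z.2%:~R ^+ 2 < r ^+ 2).
Proof.
move=> r0; rewrite /in_ball -[RHS](@ltr_sqrt R) ?exprn_gt0//.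
by rewrite sqrtr_sqr gtr0_norm.
Qed.

Lemma box_in_ball (R : realType) (r : R) (x z : Z2) : 3 < r ->
  in_ball (r - 3) x -> z \in box x -> in_ball r z.
Proof.
move=> r3; rewrite !in_ballE; [|lra|lra].
move=> hx /boxP [].
have [] : z.1%:~R = x.1%:~R + (z.1 - x.1)%:~R :> R /\
          z.2%:~R = x.2%:~R + (z.2 - x.2)%:~R :> R.
  by rewrite -!rmorphD /= !(addrC _ (_ - _)) !subrK.
move=> -> ->.
move: (z.1 - x.1) (z.2 - x.2) => p q p1 q1.
have {p1} : `|p%:~R| <= 1 :> R by rewrite -intr_norm (ler_int R _ 1).
have {q1} : `|q%:~R| <= 1 :> R by rewrite -intr_norm (ler_int R _ 1).
rewrite !ler_norml => /andP[q1 q2] /andP[p1 p2].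
move: hx q1 q2 p1 p2.
set a : R := x.1%:~R; set b : R := x.2%:~R.
move: (p%:~R) (q%:~R) => P Q hx q1 q2 p1 p2.
have ha : `|a| < r - 3.
  rewrite -(@ltr_pXn2r _ 2%N) ?nnegrE ?normr_ge0//; last by lra.
  by rewrite real_normK ?num_real//; have := sqr_ge0 b; lra.
have hb : `|b| < r - 3.
  rewrite -(@ltr_pXn2r _ 2%N) ?nnegrE ?normr_ge0//; last by lra.
  by rewrite real_normK ?num_real//; have := sqr_ge0 a; lra.
have aP : a * P <= r - 3.
  apply: le_trans (ler_norm _) _; rewrite normrM.
  have : `|P| <= 1 by rewrite ler_norml p1.
  by have := normr_ge0 a; have := normr_ge0 P; nra.
have bQ : b * Q <= r - 3.
  apply: le_trans (ler_norm _) _; rewrite normrM.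
  have : `|Q| <= 1 by rewrite ler_norml q1.
  by have := normr_ge0 b; have := normr_ge0 Q; nra.
have P2 : P ^+ 2 <= 1 by nra.
have Q2 : Q ^+ 2 <= 1 by nra.
rewrite !sqrrD; lra.
Qed.

Lemma box_origin (R : realType) (x : Z2) :
  ~~ in_ball (3 : R) x -> origin \notin box x.
Proof.
apply: contra => /boxP [] /=; rewrite !sub0r !normrN => h1 h2.
rewrite in_ballE; last by lra.
have : x.1 ^+ 2 + x.2 ^+ 2 < 3 ^+ 2 by nia.
by rewrite -(ltr_int R) rmorphD !rmorphXn.
Qed.

Lemma in_ball_bdry (R : realType) (r : R) z : in_ball r z -> in_bdry r z = false.
Proof. by rewrite /in_bdry => ->. Qed.

(** * Reaching x without returning to the origin *)

(** Iterates [box_reach_centre]: each centre lies in the box of the next one, so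
    that the next leg can start there. *)
Lemma chain_reach c0 cs y eta : path (fun c c' => c \in box c') c0 cs ->
  y \in box c0 ->
  exists s, [/\ walk eta y s, last y s = last c0 cs &
    forall z, z \in s -> exists2 c, c \in c0 :: cs & z \in box c].
Proof.
elim: cs c0 y eta => [|c cs IH] c0 y eta /= pth yc0.
  have [s [sx sw sl]] := box_reach_centre eta yc0.
  by exists s; split => // z /sx ?; exists c0; rewrite ?mem_head.
case/andP: pth => c0c pth.
have [s [sx sw sl]] := box_reach_centre eta yc0.
have [t [tw tl tx]] := IH c c0 (relabel eta (belast y s)) pth c0c.
exists (s ++ t); split.
- by rewrite walk_cat sw sl tw.
- by rewrite last_cat sl tl.
- move=> z; rewrite mem_cat => /orP[/sx ?|/tx [c' c'c ?]].
    by exists c0; rewrite ?mem_head.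
  by exists c' => //; rewrite in_cons c'c orbT.
Qed.

(** The sites at distance 2 from the origin in the maximum norm: the centres
    closest to the origin whose boxes miss it, in cyclic order. *)
Definition ring_sites : seq Z2 :=
  [:: (2, 0); (2, 1); (2, 2); (1, 2); (0, 2); (-1, 2); (-2, 2); (-2, 1);
      (-2, 0); (-2, -1); (-2, -2); (-1, -2); (0, -2); (1, -2); (2, -2); (2, -1)].

Lemma ring_connected u c : u \in ring_sites -> c \in ring_sites ->
  exists cs, [/\ path (fun c c' => c \in box c') u cs, last u cs = c &
    {subset cs <= ring_sites}].
Proof.
move=> ur cr.
have /allP/(_ _ ur)/allP/(_ _ cr)/hasP : all (fun u => all (fun c => has (fun i =>
    let cs := take i (behead (rot (index u ring_sites) ring_sites)) in
    path (fun c c' => c \in box c') u cs && (last u cs == c))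
  (iota 0 16)) ring_sites) ring_sites by vm_compute.
move=> [i _ /andP[h1 /eqP h2]]; eexists; split; [exact: h1|exact: h2|].
by move=> z /mem_take /mem_behead; rewrite mem_rot.
Qed.

Lemma mem_ring (c : Z2) : (c \in ring_sites) = (maxn `|c.1| `|c.2| == 2)%N.
Proof.
apply/idP/idP => [|h].
  by move: c; apply/allP.
have : c \in [seq (a, b) | a <- [:: -2; -1; 0; 1; 2], b <- [:: -2; -1; 0; 1; 2]].
  have c1 : (absz c.1 <= 2)%N by lia.
  have c2 : (absz c.2 <= 2)%N by lia.
  have small p : (absz p <= 2)%N -> p \in [:: -2; -1; 0; 1; 2].
    by case: p => [[|[|[|n]]]|[|[|n]]].
  by apply/allpairsP; exists c; split; [exact: small..|case: (c)].
move=> cc; apply/implyP: (h); move: (c) cc; apply/allP; by vm_compute.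
Qed.

Lemma origin_notin_box (c : Z2) :
  (origin \notin box c) = (1 < maxn (absz c.1) (absz c.2))%N.
Proof.
rewrite ltnNge; congr (~~ _); apply/boxP/idP => /= [[]|]; first lia.
by move=> h; split; lia.
Qed.

(** Reducing the larger coordinate of [c] by one in absolute value decreases the
    Euclidean norm and keeps the box away from the origin until [c] is in the
    ring, which is connected. *)
Lemma centres_to (u c : Z2) : u \in ring_sites -> origin \notin box c ->
  exists cs, [/\ path (fun c c' => c \in box c') u cs, last u cs = c &
    forall c', c' \in cs -> origin \notin box c' /\
      (c' \in ring_sites \/ (c'.1 ^+ 2 + c'.2 ^+ 2 <= c.1 ^+ 2 + c.2 ^+ 2))].
Proof.
move=> ur.
have ring0 c' : c' \in ring_sites -> origin \notin box c'.
  by rewrite mem_ring origin_notin_box => /eqP ->.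
have [n] := ubnP (`|c.1| + `|c.2|)%N; elim: n c => // n IH c cn c0.
have [cr|cr] := boolP (c \in ring_sites).
  have [cs [h1 h2 h3]] := ring_connected ur cr.
  by exists cs; split=> // c' /h3 c'r; split; [exact: ring0|left].
have c3 : (2 < maxn `|c.1| `|c.2|)%N.
  rewrite mem_ring in cr.
  by rewrite ltn_neqAle eq_sym cr -origin_notin_box.
have step c1 : c1 \in box c -> (`|c1.1| + `|c1.2| < `|c.1| + `|c.2|)%N ->
    (1 < maxn `|c1.1| `|c1.2|)%N ->
    c1.1 ^+ 2 + c1.2 ^+ 2 <= c.1 ^+ 2 + c.2 ^+ 2 ->
    exists cs, [/\ path (fun c c' => c \in box c') u cs, last u cs = c &
    forall c', c' \in cs -> origin \notin box c' /\
      (c' \in ring_sites \/ (c'.1 ^+ 2 + c'.2 ^+ 2 <= c.1 ^+ 2 + c.2 ^+ 2))].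
  move=> c1c c1n c12 c1le.
  have c10 : origin \notin box c1 by rewrite origin_notin_box.
  have [cs [h1 h2 h3]] := IH c1 (leq_trans c1n cn) c10.
  exists (rcons cs c); split; rewrite ?last_rcons//.
    by rewrite rcons_path h1 h2.
  move=> c'; rewrite mem_rcons inE => /predU1P[->|/h3 [h4 [h5|h5]]].
  - by split => //; right.
  - by split => //; left.
  - by split => //; right; apply: le_trans h5 c1le.
have [h12|h12] := leqP (absz c.1) (absz c.2).
  have [c2|c2] := leP 0 c.2.
    apply: (step (c.1, c.2 - 1)) => /=; [apply/boxP => /=; lia|lia|lia|nia].
  apply: (step (c.1, c.2 + 1)) => /=; [apply/boxP => /=; lia|lia|lia|nia].
have [c2|c2] := leP 0 c.1.
  apply: (step (c.1 - 1, c.2)) => /=; [apply/boxP => /=; lia|lia|lia|nia].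
apply: (step (c.1 + 1, c.2)) => /=; [apply/boxP => /=; lia|lia|lia|nia].
Qed.

(** Moving away from the vertical axis keeps the boxes away from the origin. *)
Lemma outward (x : Z2) (n : nat) : origin \notin box x ->
  exists cs, [/\ path (fun c c' => c \in box c') x cs,
    forall c, c \in cs -> origin \notin box c &
    (n <= absz (last x cs).1)%N].
Proof.
move=> x0; elim: n => [|n [cs [h1 h2 h3]]]; first by exists [::].
pose c := last x cs.
have c0 : origin \notin box c.
  by move: (mem_last x cs); rewrite inE -/c => /predU1P[->|/h2].
pose c' : Z2 := (if 0 <= c.1 then c.1 + 1 else c.1 - 1, c.2).
have c'c : c \in box c'.
  by apply/boxP; rewrite /c' /=; split; [case: ifP|]; lia.
have hn : (absz c.1 < absz c'.1)%N by rewrite /c' /=; case: ifP; lia.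
exists (rcons cs c'); split.
- by rewrite rcons_path h1 -/c c'c.
- move=> d; rewrite mem_rcons inE => /predU1P[->|/h2 //].
  rewrite !origin_notin_box in c0 *; apply: leq_trans c0 _.
  by rewrite geq_max !leq_max leqnn (ltnW hn) orbT.
- by rewrite last_rcons; exact: leq_ltn_trans h3 hn.
Qed.

(** The initial label decides the axis of the first step, but its sign is free.
    The box centred at twice the first site contains that site and not the
    origin, so a chain of boxes can start there. *)
Lemma escape (R : realType) (r : R) (x : Z2) (rho : config) :
  6 <= r -> in_ball (r - 3) x -> ~~ in_ball (3 : R) x ->
  exists s1 s2, [/\ walk rho origin (s1 ++ s2), last origin s1 = x,
    origin \notin s1 ++ s2, {in s1, forall z, in_ball r z} &
    ~~ in_ball r (last x s2)].
Proof.
move=> hr hx hx3; have x0 := box_origin hx3.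
pose h := isH (flip (rho origin)).
pose u := origin + (if h then e1 else e2).
have uh : u \in axis_nbrs h origin.
  by rewrite /u /axis_nbrs; case: (h); rewrite mem_head.
have ur : u + u \in ring_sites by rewrite /u; case: (h).
have uu : u \in box (u + u) by rewrite /u; case: (h).
have u0 : origin \notin box (u + u) by rewrite /u; case: (h).
have [cs1 [p1 l1 b1]] := centres_to ur x0.
have [s1 [w1 ls1 m1]] := chain_reach (flip_at origin rho) p1 uu.
have [n rn] : exists n : nat, r < n%:R.
  by exists (Num.bound r); apply: le_lt_trans (archi_boundP _); rewrite ?ler_norm; lra.
have [cs2 [p2 b2 l2]] := outward n x0.
have xx : x \in box x by apply/boxP; rewrite !subrr normr0.
have [s2 [w2 ls2 m2]] :=
  chain_reach (relabel rho (belast origin (u :: s1))) p2 xx.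
exists (u :: s1), s2; split.
- by rewrite walk_cat /= uh w1 /= ls1 l1.
- by rewrite /= ls1.
- rewrite mem_cat; apply/norP; split.
    rewrite inE; apply/norP; split; first by rewrite /u; case: (h).
    apply/negP => /m1 [c]; rewrite inE => /predU1P[->|/b1 [/negP //]].
    by move/negP: u0.
  apply/negP => /m2 [c]; rewrite inE => /predU1P[->|/b2 /negP //].
  by move/negP: x0.
- have ball c : c \in u + u :: cs1 -> in_ball (r - 3) c.
    have r9 : 3 ^+ 2 <= (r - 3) ^+ 2.
      by rewrite ler_pXn2r ?nnegrE//; lra.
    have cr d : d \in ring_sites -> in_ball (r - 3) d.
      move=> dr; rewrite in_ballE; last lra.
      apply: lt_le_trans r9.
      have /allP/(_ d dr) : all (fun d : Z2 => d.1 ^+ 2 + d.2 ^+ 2 < 3 ^+ 2)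
        ring_sites by vm_compute.
      by rewrite -(ltr_int R) rmorphD !rmorphXn.
    rewrite inE => /predU1P[->|/b1 [_ [|]]]; [exact: cr|exact: cr|].
    rewrite -(ler_int R) !rmorphD !rmorphXn /= => cx.
    move: hx; rewrite !in_ballE; [exact: le_lt_trans|lra|lra].
  move=> z; rewrite inE => /predU1P[->|/m1 [c cc zc]].
    by apply: box_in_ball uu; [lra|apply: ball; rewrite mem_head].
  by apply: box_in_ball zc; [lra|apply: ball].
- rewrite ls2 -leNgt; apply/ltW/(lt_le_trans rn).
  set c := last x cs2 in l2 *.
  rewrite /enorm; apply: (@le_trans _ _ (Num.sqrt (c.1%:~R ^+ 2))).
    rewrite sqrtr_sqr -intr_norm.
    by rewrite (pmulrn 1 n) (ler_int R n) -abszE lez_nat.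
  by rewrite ler_wsqrtr// lerDl sqr_ge0.
Qed.

(** * Stopping *)

(** A path is given by its positions at times 1, 2, ..., because it always
    starts at the origin. *)
Definition traj (s : seq Z2) : nat -> Z2 := nth origin (origin :: s).

Lemma traj_take s m : (m <= size s)%N -> traj s m = last origin (take m s).
Proof.
move=> ms; rewrite (last_nth origin) size_takel// /traj.
by case: m ms => [|m] ms //=; rewrite nth_take.
Qed.

Fixpoint arrivals (y : Z2) (s : seq Z2) : nat :=
  if s is z :: s' then ((y != origin) && (z == origin)) + arrivals z s' else 0%N.

Lemma arrivals_cat y s1 s2 :
  arrivals y (s1 ++ s2) = (arrivals y s1 + arrivals (last y s1) s2)%N.
Proof. by elim: s1 y => [|z s1 IH] y //=; rewrite IH addnA. Qed.

Lemma arrivals_notin y s : origin \notin s -> arrivals y s = 0%N.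
Proof.
elim: s y => //= z s IH y; rewrite inE eq_sym => /norP[/negPf -> /IH ->].
by rewrite andbF.
Qed.

Lemma returns_traj s m : (m <= size s)%N ->
  returns (traj s) m = arrivals origin (take m s).
Proof.
elim: m => [|m IH] ms; first by rewrite take0.
rewrite (take_nth origin ms) -cats1 arrivals_cat -IH ?(ltnW ms)// /= addn0.
rewrite /returns -[in iota _ m.+1](addn1 m) iotaD count_cat /= addn0 add1n /=.
by rewrite [traj s m]traj_take// ltnW.
Qed.

Lemma visits_traj s x : visits (traj s) x (size s) = count_mem x s.
Proof.
rewrite /visits (iotaDl 1 0) count_map -[s in RHS](mkseq_nth origin) /mkseq.
by rewrite count_map; apply: eq_count => i.
Qed.

Section Stopping.
Variables (R : realType) (r : R) (k : nat).

Definition stop (s : seq Z2) : bool :=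
  (arrivals origin s == k) || in_bdry r (last origin s).

Definition halts (s : seq Z2) : Prop :=
  stop s /\ forall m, (m < size s)%N -> ~~ stop (take m s).

Lemma stopped_traj s m : (m <= size s)%N ->
  stopped r k (traj s) m = stop (take m s).
Proof. by move=> ms; rewrite /stopped returns_traj// traj_take. Qed.

Lemma is_tau_traj s : is_tau r k (traj s) (size s) <-> halts s.
Proof.
rewrite /is_tau /halts stopped_traj// take_size.
by split=> -[-> H]; split => // m ms; move: (H m ms);
  rewrite stopped_traj// ltnW.
Qed.

Lemma halts_cat_nonstop s1 s2 : halts (s1 ++ s2) -> s2 != [::] -> ~~ stop s1.
Proof.
move=> [_ H] s20; have := H (size s1); rewrite take_size_cat//; apply.
by rewrite size_cat -addn1 leq_add2l lt0n size_eq0.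
Qed.

Lemma halts_nonbdry s : halts s ->
  all (fun y => ~~ in_bdry r y) (belast origin s).
Proof.
move=> [_ H]; apply/(all_nthP origin) => m; rewrite size_belast => ms.
have -> : nth origin (belast origin s) m = last origin (take m s).
  rewrite -traj_take ?(ltnW ms)// /traj lastI -cats1 nth_cat size_belast.
  by rewrite ms.
by apply: contra (H m ms) => h; rewrite /stop h orbT.
Qed.

(** A loop inside a set that contains neither the origin nor boundary sites
    changes neither the number of returns nor the moment of stopping, as long
    as the walker has not stopped when the loop begins. *)
Lemma halts_loop (B s1 d s2 : seq Z2) : {subset d <= B} -> last origin s1 \in B ->
  origin \notin B -> {in B, forall z, ~~ in_bdry r z} ->
  last (last origin s1) d = last origin s1 -> s2 != [::] ->
  halts (s1 ++ s2) -> halts (s1 ++ d ++ s2).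
Proof.
move=> dB s1B oB bB ld s20 Hs.
have nin (e : seq Z2) : {subset e <= B} -> origin \notin e.
  by move=> eB; apply: contra oB => /eB.
have stopE u : stop (s1 ++ d ++ u) = stop (s1 ++ u).
  rewrite /stop !arrivals_cat !last_cat ld.
  by rewrite (arrivals_notin _ (nin _ dB)).
split; first by rewrite stopE; case: Hs.
move=> m; rewrite !size_cat => ms.
have ns1 := halts_cat_nonstop Hs s20.
rewrite take_cat; case: ltnP => m1.
  have := (proj2 Hs) m; rewrite take_cat m1; apply.
  by rewrite size_cat ltn_addr.
rewrite take_cat; case: ltnP => m2.
  have tB : {subset take (m - size s1) d <= B} by move=> z /mem_take /dB.
  rewrite /stop arrivals_cat (arrivals_notin _ (nin _ tB)) addn0 last_cat.
  move: ns1; rewrite /stop negb_or => /andP[/negPf -> _] /=.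
  apply: bB; move: (mem_last (last origin s1) (take (m - size s1) d)).
  by rewrite inE => /predU1P[->|/tB].
rewrite stopE; set j := (_ - _ - _)%N.
have := (proj2 Hs) (size s1 + j)%N.
rewrite take_cat [(_ < size s1)%N]ltnNge leq_addr /= addKn.
by apply; rewrite size_cat ltn_add2l /j; lia.
Qed.

End Stopping.

(** * Surgery at the last departure from the box *)

Lemma split_last_in (B : seq Z2) (y : Z2) (s : seq Z2) : has (mem B) s ->
  exists s1 s2, [/\ s = s1 ++ s2, last y s1 \in B & all (predC (mem B)) s2].
Proof.
elim/last_ind: s => // s z IH; rewrite has_rcons.
have [zB _|zB] := boolP (z \in B).
  by exists (rcons s z), [::]; rewrite cats0 last_rcons.
rewrite /= (negPf zB) => /IH [s1 [s2 [-> h1 h2]]].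
by exists s1, (rcons s2 z); rewrite rcons_cat all_rcons h2 /= zB.
Qed.

(** Otherwise [a2] would extend [a1] by a nonempty part of [b1], which misses
    [B], and could not end in [B]. *)
Lemma last_in_cut_le (B : seq Z2) (y : Z2) (a1 b1 a2 b2 : seq Z2) : y \notin B ->
  a1 ++ b1 = a2 ++ b2 -> last y a2 \in B -> all (predC (mem B)) b1 ->
  (size a2 <= size a1)%N.
Proof.
move=> yB e l2 n1; rewrite leqNgt; apply/negP => lt.
have e2 : a2 = a1 ++ take (size a2 - size a1) b1.
  by rewrite -[LHS](take_size_cat b2 (erefl _)) -e take_cat ltnNge (ltnW lt).
move: l2; rewrite {1}e2 last_cat.
move: (size a2 - size a1)%N (subn_gt0 (size a1) (size a2)) => n.
rewrite lt => n0.
case: b1 n1 e e2 n0 => [|z b1] n1 e e2 n0.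
  by move: lt; rewrite {1}e2 cats0 ltnn.
case: n n0 e2 => // n _ e2 /=.
have : all (predC (mem B)) (take n.+1 (z :: b1)).
  by apply/allP => w /mem_take; apply/allP.
move=> /allP /(_ (last z (take n b1))); rewrite mem_last => /(_ isT) /=.
by move=> /negP.
Qed.

Lemma last_in_cut_inj (B : seq Z2) (y : Z2) (a1 b1 a2 b2 : seq Z2) : y \notin B ->
  a1 ++ b1 = a2 ++ b2 -> last y a1 \in B -> last y a2 \in B ->
  all (predC (mem B)) b1 -> all (predC (mem B)) b2 -> size a1 = size a2.
Proof.
move=> yB e l1 l2 n1 n2; apply/eqP; rewrite eqn_leq.
by rewrite (last_in_cut_le yB (esym e) l1 n2) (last_in_cut_le yB e l2 n1).
Qed.

Lemma origin_in_ball (R : realType) (r : R) : 0 < r -> in_ball r origin.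
Proof. by move=> r0; rewrite in_ballE// !expr0n addr0 exprn_gt0. Qed.

Section Surgery.
Variables (R : realType) (r : R) (k : nat) (x : Z2) (rho : config).
Hypotheses (hr : 6 <= r) (hx : in_ball (r - 3) x) (hx3 : ~~ in_ball (3 : R) x).

Definition stopped_walk (p : bool) (s : seq Z2) : Prop :=
  [/\ walk rho origin s, halts r k s, x \in s & odd (count_mem x s) = p].

(** The last two conditions say that the inserted stretch ends at the last visit
    of [s'] to the box; this is what allows undoing the insertion. *)
Definition inserts (m : nat) (s s' : seq Z2) : Prop :=
  exists s1 d s2, [/\ s = s1 ++ s2, s' = s1 ++ d ++ s2, size d = m,
    last origin (s1 ++ d) \in box x & all (predC (mem (box x))) s2].

(** The end of the inserted stretch is recognisable in [u] as its last visit to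
    the box, and the length of the stretch then locates its beginning. *)
Lemma inserts_inj m s t u : inserts m s u -> inserts m t u -> s = t.
Proof.
move=> [s1 [d [s2 [-> -> dm l n]]]] [t1 [e [t2 [-> ee em l' n']]]].
rewrite !catA in ee.
have sz := last_in_cut_inj (box_origin hx3) ee l l' n n'.
move/eqP: ee; rewrite eqseq_cat// => /andP[/eqP ee /eqP ->].
move: sz; rewrite !size_cat dm em => /addIn sz.
by move/eqP: ee; rewrite eqseq_cat// => /andP[/eqP -> _].
Qed.

Lemma size_inserts m s s' : inserts m s s' -> size s' = (size s + m)%N.
Proof.
by move=> [s1 [d [s2 [-> -> <- _ _]]]]; rewrite !size_cat addnCA addnC.
Qed.

Lemma xbox : x \in box x. Proof. by apply/boxP; rewrite !subrr normr0. Qed.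

Lemma box_nonbdry : {in box x, forall z, ~~ in_bdry r z}.
Proof.
move=> z zx; rewrite in_ball_bdry//; apply: box_in_ball zx => //.
by apply: lt_le_trans hr; rewrite ltr_nat.
Qed.

(** The path ends at the boundary or with an arrival at the origin: if it ended
    elsewhere with [k] returns, it would have stopped earlier. *)
Lemma halts_last s : halts r k s -> last origin s \notin box x.
Proof.
move=> hs; apply/negP => lx; case: (hs).
rewrite /stop (negPf (box_nonbdry lx)) orbF => sk _.
case/lastP: s => [|s z] in hs lx sk *; first by rewrite (negPf (box_origin hx3)) in lx.
rewrite last_rcons in lx.
have oz : origin \notin [:: z].
  by rewrite inE; apply: contraNneq (box_origin hx3) => ->.
have := halts_cat_nonstop (s1 := s) (s2 := [:: z]).
rewrite cats1 => /(_ _ r k hs isT); rewrite /stop negb_or => /andP[/negP + _].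
by apply; rewrite -cats1 arrivals_cat (arrivals_notin _ oz) addn0 in sk.
Qed.

(** After the insertion, the labels differ from the original ones only inside
    the box and away from [y], hence at no site departed from later. *)
Lemma detour p s : stopped_walk p s ->
  exists m s', [/\ (m <= 14)%N, stopped_walk (~~ p) s' & inserts m s s'].
Proof.
move=> [ws hs xs sp].
have [s1 [s2 [sE l1 n2]]] : exists s1 s2,
    [/\ s = s1 ++ s2, last origin s1 \in box x & all (predC (mem (box x))) s2].
  by apply: split_last_in; apply/hasP; exists x => //; apply: xbox.
have x2 : x \notin s2 by apply/negP => /(allP n2) /=; rewrite xbox.
have s20 : s2 != [::].
  by apply: contraTneq (halts_last hs); rewrite sE => ->; rewrite cats0 l1.
case: s2 => // z s2 in sE n2 x2 s20 *; have /andP[zx n2'] := n2.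
set y := last origin s1 in l1.
set eta := relabel rho (belast origin s1).
have [w1 /andP[wz w2]] : walk rho origin s1 /\ walk eta y (z :: s2).
  by apply/andP; rewrite -walk_cat -sE.
have [d [d14 dx wd ld [dy dodd]]] := box_loop l1 zx wz.
exists (size d), (s1 ++ d ++ z :: s2); split => //; last first.
  by exists s1, d, (z :: s2); rewrite last_cat -/y ld.
split.
- rewrite !walk_cat w1 -/y -/eta wd ld.
  rewrite -(@eq_walk eta _ y (z :: s2)); first by rewrite /= wz.
  move=> w /=; rewrite inE => /predU1P[->|ws2]; first by rewrite dy.
  rewrite relabel_notin //; apply/negP => wd'.
  have wB : w \in box x.
    by move: (mem_belast wd'); rewrite inE => /predU1P[->|/dx].
  by have /(allP n2) := mem_belast ws2; rewrite /= wB.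
- apply: (halts_loop dx) => //; first exact: box_origin hx3.
  + exact: box_nonbdry.
  + by rewrite -sE.
- have : x \in d by rewrite -has_pred1 has_count; case: count dodd.
  by rewrite !mem_cat => ->; rewrite orbT.
- have c2 : count_mem x (z :: s2) = 0%N by apply/count_memPn.
  by rewrite -sp sE !count_cat c2 !addn0 oddD dodd addbT.
Qed.

(** Cut the path of [escape] when it first leaves the ball.  It has not returned
    to the origin, so it stops there and not before. *)
Lemma stopped_walk_exists : (0 < k)%N -> exists p s, stopped_walk p s.
Proof.
move=> k0; have [s1 [s2 [w l1 o b1 b2]]] := escape rho hr hx hx3.
pose s := s1 ++ s2.
have ex : exists n, ~~ in_ball r (traj s n).
  by exists (size s); rewrite traj_take// take_size last_cat l1.
have [n nb nmin] := ex_minnP ex.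
have ns : (n <= size s)%N.
  by apply: nmin; rewrite traj_take// take_size last_cat l1.
have inb m : (m < n)%N -> in_ball r (traj s m).
  by move=> mn; apply: contraLR mn => /nmin; rewrite -leqNgt.
have s1n : (size s1 < n)%N.
  rewrite ltnNge; apply: contra nb => n1.
  rewrite traj_take// /s takel_cat//.
  move: (mem_last origin (take n s1)); rewrite inE => /predU1P[->|].
    by rewrite origin_in_ball// (lt_le_trans _ hr).
  by move=> /mem_take /b1.
have o' m : arrivals origin (take m s) = 0%N.
  by apply: arrivals_notin; apply: contra o => /mem_take.
have k0' : (0 == k)%N = false by case: (k) k0.
have xt : x \in take n s.
  rewrite /s take_cat ltnNge (ltnW s1n) /= mem_cat -l1.
  move: (mem_last origin s1); rewrite inE l1 => /predU1P[x0|->//].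
  by move: hx3; rewrite x0 origin_in_ball.
exists (odd (count_mem x (take n s))), (take n s); split => //.
- by move: w; rewrite -/s -[in X in X -> _](cat_take_drop n s) walk_cat => /andP[].
- split.
    rewrite /stop o' k0' orFb -traj_take// /in_bdry nb andTb.
    case: n ns s1n nb nmin inb xt => // n ns _ nb _ inb _.
    apply/hasP; exists (traj s n); last exact: inb.
    have [h] : exists h, traj s n.+1 \in axis_nbrs h (traj s n).
      move: w; rewrite -/s -[s in walk _ _ s](cat_take_drop n) walk_cat.
      rewrite (drop_nth origin ns) /= => /andP[_ /andP[+ _]].
      rewrite -traj_take ?(ltnW ns)// => ?; eexists; eassumption.
    move: (traj s n) (traj s n.+1) => a b.
    rewrite /nbrs mem_cat /axis_nbrs /horizontal_nbrs /vertical_nbrs.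
    by case: h; rewrite !inE => /orP[]/eqP->;
      rewrite ?addrK ?subrK eqxx ?orbT.
  move=> m; rewrite size_takel// => mn; rewrite take_takel ?(ltnW mn)//.
  rewrite /stop o' k0' /= -traj_take; last exact: leq_trans (ltnW mn) ns.
  by rewrite in_ball_bdry// inb.
Qed.
End Surgery.

(** * Probability *)

Section Probability.
Local Open Scope classical_set_scope.
Context (R : realType) (k : nat) (r : R) (x : Z2) (rho : config).
Context (d : measure_display) (Omega : measurableType d) (P : probability Omega R).
Context (Y : nat -> Omega -> Z2) (zeta : nat -> Omega -> config).
Hypotheses (hr : 6 <= r) (hx : in_ball (r - 3) x) (hx3 : ~~ in_ball (3 : R) x).
Hypothesis (hY : HV_walk P r rho Y zeta).

Definition cyl (s : seq Z2) : set Omega :=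
  [set w | forall i, (i <= size s)%N -> Y i w = traj s i].

Lemma cyl_nil : cyl [::] = setT.
Proof.
apply/seteqP; split => // w _ i; rewrite leqn0 => /eqP ->.
by rewrite (HV_start hY).
Qed.

Lemma cyl_rcons s z : cyl (rcons s z) = cyl s `&` [set w | Y (size s).+1 w = z].
Proof.
have tr i : (i <= size s)%N -> traj (rcons s z) i = traj s i.
  by move=> si; rewrite /traj -rcons_cons nth_rcons ltnS si.
apply/seteqP; split=> w.
  move=> h; split.
    by move=> i si; rewrite h ?tr// size_rcons ltnW.
  by rewrite /= h ?size_rcons// /traj -rcons_cons nth_rcons ltnn eqxx.
move=> [h1 h2] i; rewrite size_rcons leq_eqVlt ltnS => /predU1P[->|si].
  by rewrite h2 /traj -rcons_cons nth_rcons ltnn eqxx.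
by rewrite tr// h1.
Qed.

Lemma measurable_cyl s : measurable (cyl s).
Proof.
elim/last_ind: s => [|s z IH]; first by rewrite cyl_nil.
by rewrite cyl_rcons; apply: measurableI => //; apply: (HV_measurable hY).
Qed.

Lemma zeta_cyl s w : all (fun y => ~~ in_bdry r y) (belast origin s) ->
  cyl s w -> zeta (size s) w = relabel rho (belast origin s).
Proof.
elim/last_ind: s => [|s z IH]; first by rewrite (HV_labels0 hY).
rewrite belast_rcons lastI all_rcons cyl_rcons size_rcons => /andP[nl nb] [ws _].
rewrite (HV_labelsS hY) IH// ws// traj_take// take_size /update (negPf nl).
by rewrite flip_atE -relabel_cat cats1.
Qed.

Definition weight (s : seq Z2) : R :=
  if walk rho origin s then 2 ^- size s else 0.

(** Before the path stops, each step conforming to the current label has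
    conditional probability one half and any other step has probability zero,
    and the labels are a function of the path. *)
Lemma prob_cyl s : all (fun y => ~~ in_bdry r y) (belast origin s) ->
  P (cyl s) = (weight s)%:E.
Proof.
elim/last_ind: s => [|s z IH].
  by rewrite cyl_nil probability_setT /weight /= expr0 invr1.
rewrite belast_rcons lastI => nb.
have nbs : all (fun y => ~~ in_bdry r y) (belast origin s).
  by move: nb; rewrite all_rcons => /andP[].
pose eta := relabel rho (origin :: s).
have past : [set w | (forall i, (i <= size s)%N -> Y i w = traj s i) /\
    zeta (size s).+1 w = eta] = cyl s.
  apply/seteqP; split => [w [] //|w ws]; split => //.
  rewrite (HV_labelsS hY) zeta_cyl// ws// traj_take// take_size /update.
  move: nb; rewrite all_rcons => /andP[/negPf -> _].
  by rewrite flip_atE -relabel_cat cats1 -lastI.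
have := HV_move hY (size s) (traj s) eta z; rewrite /= past -cyl_rcons => ->.
rewrite IH// -EFinM /weight -cats1 walk_cat traj_take// take_size; congr _%:E.
case: (walk rho origin s) => /=; last by rewrite mul0r.
rewrite andbT /step_prob; move: nb; rewrite all_rcons => /andP[/negPf -> _].
have -> : eta (last origin s) =
    flip (relabel rho (belast origin s) (last origin s)).
  by rewrite /eta lastI -cats1 relabel_cat -flip_atE /flip_at eqxx.
rewrite size_cat addn1 exprSr invfM /axis_nbrs.
by case: (flip _) => /=; case: ifP; rewrite ?mulr0// mulrC.
Qed.

(** A trajectory determines its stopping time, and thereby the stopped path:
    the cylinders of stopped paths are pairwise disjoint. *)
Lemma halts_cyl_inj s t w : halts r k s -> halts r k t ->
  cyl s w -> cyl t w -> s = t.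
Proof.
have le u v : halts r k u -> halts r k v -> cyl u w -> cyl v w ->
    (size u <= size v)%N.
  move=> [_ hu] [hv _] wu wv; rewrite leqNgt; apply/negP => vu.
  suff e : take (size v) u = v by have := hu _ vu; rewrite e hv.
  apply: (@eq_from_nth _ origin); rewrite size_takel ?(ltnW vu)// => i iv.
  rewrite nth_take// -[LHS]/(traj u i.+1) -[RHS]/(traj v i.+1) -wu -?wv//.
  by rewrite (leq_trans iv)// ltnW.
move=> hs ht ws wt; have st : size s = size t.
  by apply/eqP; rewrite eqn_leq !le.
apply: (@eq_from_nth _ origin) => // i si.
by rewrite -[LHS]/(traj s i.+1) -[RHS]/(traj t i.+1) -ws -?wt// -st.
Qed.

Definition event (Q : set (seq Z2)) : set Omega :=
  [set w | exists2 s, Q s & cyl s w].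

(** Paths form a countable type; this enumerates the cylinders making up
    [event Q] by natural numbers, with the empty set at unused codes. *)
Definition event_code (Q : set (seq Z2)) (n : nat) : set Omega :=
  [set w | exists2 s, Q s /\ pickle s = n & cyl s w].

Lemma event_bigcup Q : event Q = \bigcup_n event_code Q n.
Proof.
apply/seteqP; split=> [w [s Qs ws]|w [n _ [s [Qs _] ws]]]; last by exists s.
by exists (pickle s) => //; exists s.
Qed.

Lemma event_codeP Q n :
  event_code Q n = set0 \/ exists s, [/\ Q s, pickle s = n & event_code Q n = cyl s].
Proof.
have [[s [Qs sn]]|H] := pselect (exists s, Q s /\ pickle s = n); last first.
  by left; apply/seteqP; split => // w [s Hs _]; apply: H; exists s.
right; exists s; split => //; apply/seteqP; split => [w [t [_ tn] wt]|w ws].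
  by have -> // : s = t; apply: (pcan_inj pickleK); rewrite sn tn.
by exists s.
Qed.

Lemma measurable_event_code Q n : measurable (event_code Q n).
Proof.
by case: (event_codeP Q n) => [->|[s [_ _ ->]]] //; apply: measurable_cyl.
Qed.

Lemma measurable_event Q : measurable (event Q).
Proof.
rewrite event_bigcup; apply: bigcup_measurable => n _.
exact: measurable_event_code.
Qed.

Lemma prob_event_ge Q (S : seq (seq Z2)) : Q `<=` halts r k -> uniq S ->
  (forall s, s \in S -> Q s) -> (\sum_(s <- S) P (cyl s) <= P (event Q))%E.
Proof.
move=> Qh uS QS.
suff H A : measurable A -> (forall s, s \in S -> cyl s `<=` A) ->
    (\sum_(s <- S) P (cyl s) <= P A)%E.
  by apply: H => [|s /QS Qs w ws]; [exact: measurable_event|exists s].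
elim: S uS QS A => [|s S IH] /= uS QS A mA SA.
  by rewrite big_nil measure_ge0.
case/andP: uS => sS uS.
rewrite big_cons (measureDI P mA (measurable_cyl s)) addeC.
have -> : A `&` cyl s = cyl s by apply/setIidr/SA; rewrite mem_head.
apply: leeD => //; apply: IH => //.
- by move=> t tS; apply: QS; rewrite in_cons tS orbT.
- by apply: measurableD => //; exact: measurable_cyl.
- move=> t tS w wt; split; first by apply: SA wt; rewrite in_cons tS orbT.
  move=> ws; move: sS; rewrite (@halts_cyl_inj s t w) ?tS//; apply/Qh/QS.
    by rewrite mem_head.
  by rewrite in_cons tS orbT.
Qed.

(** By countable additivity, the probability is the limit of sums over finitely
    many paths. *)
Lemma prob_event_le Q (c : \bar R) : Q `<=` halts r k ->
  (forall S, uniq S -> (forall s, s \in S -> Q s) ->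
     \sum_(s <- S) P (cyl s) <= c)%E -> (P (event Q) <= c)%E.
Proof.
move=> Qh H; rewrite event_bigcup measure_bigcup//=; last 2 first.
- by move=> n _; exact: measurable_event_code.
- move=> m n _ _ [w [[s [Qs <-] ws] [t [Qt <-] wt]]].
  by rewrite (@halts_cyl_inj s t w)//; apply: Qh.
apply: lime_le.
  by apply: is_cvg_nneseries => n _ _; exact: measure_ge0.
apply: nearW => N.
suff [S [uS QS _ ->]] : exists S, [/\ uniq S, forall s, s \in S -> Q s,
    forall s, s \in S -> (pickle s < N)%N &
    (\sum_(0 <= i < N | i \in setT) P (event_code Q i) =
     \sum_(s <- S) P (cyl s))%E] by exact: H.
elim: N => [|N [S [uS QS SN eS]]].
  by exists [::]; split => //; rewrite big_geq// big_nil.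
case: (event_codeP Q N) => [e|[s [Qs sN e]]].
  exists S; split => //; first by move=> s /SN /ltnW.
  by rewrite big_mkcond big_nat_recr//= -big_mkcond eS in_setT e measure0 adde0.
exists (s :: S); split => /=.
- by rewrite uS andbT; apply/negP => /SN; rewrite sN ltnn.
- by move=> t; rewrite inE => /predU1P[->|/QS].
- by move=> t; rewrite inE => /predU1P[->|/SN /ltnW //]; rewrite sN.
- by rewrite big_mkcond big_nat_recr//= -big_mkcond eS in_setT e big_cons addeC.
Qed.

Definition stopped_at (p : bool) : set (seq Z2) :=
  [set s | [/\ halts r k s, x \in s & odd (count_mem x s) = p]].

(** Over a finite set of paths of parity [p], sort the paths by the length [j]
    of the inserted loop.  For each [j] the surgery is injective into the paths
    of the other parity and divides the weight by 2^j; paths that violate the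
    labels have weight zero. *)
Lemma parity_le p :
  (P (event (stopped_at p)) <=
   (15 * 2 ^+ 14)%:E * P (event (stopped_at (~~ p))))%E.
Proof.
have st q : stopped_at q `<=` halts r k by move=> s [].
have /choice [f Hf] : forall s, exists ms : nat * seq Z2,
    stopped_walk r k x rho p s ->
    [/\ (ms.1 <= 14)%N, stopped_walk r k x rho (~~ p) ms.2 &
        inserts x ms.1 s ms.2].
  move=> s; have [sp|nsp] := pselect (stopped_walk r k x rho p s).
    by have [m [s' H]] := detour hr hx hx3 sp; exists (m, s').
  by exists (0%N, [::]) => /nsp.
apply: prob_event_le => // S uS Sp.
have pE : P (event (stopped_at (~~ p))) \is a fin_num.
  by apply: fin_num_measure; exact: measurable_event.
set e' := P _ in pE *; rewrite -(fineK pE); set c := fine _.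
have wE q s : stopped_at q s -> P (cyl s) = (weight s)%:E.
  by move=> [hs _ _]; apply/prob_cyl/halts_nonbdry/hs.
have -> : (\sum_(s <- S) P (cyl s) = \sum_(s <- S) (weight s)%:E)%E.
  by apply: eq_big_seq => s /Sp /wE.
rewrite sumEFin -EFinM lee_fin.
rewrite (bigID (walk rho origin)) /= [X in _ + X]big1 ?addr0; last first.
  by move=> s /negPf ns; rewrite /weight ns.
rewrite (partition_big (fun s => inord (f s).1 : 'I_15) xpredT)//=.
have -> : 15 * 2 ^+ 14 * c = \sum_(j < 15) (2 ^+ 14 * c).
  by rewrite sumr_const card_ord -[RHS]mulr_natl mulrA.
apply: ler_sum => j _; rewrite -big_filter; set Sj := [seq s <- S | _].
have SjP s : s \in Sj -> stopped_walk r k x rho p s /\ (f s).1 = j.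
  rewrite mem_filter => /andP[/andP[ws /eqP <-] /Sp [h1 h2 h3]].
  have sw : stopped_walk r k x rho p s by [].
  by split => //; have [f14 _ _] := Hf s sw; rewrite inordK.
have uT : uniq [seq (f s).2 | s <- Sj].
  rewrite map_inj_in_uniq ?filter_uniq// => s t /SjP [hs fs] /SjP [ht ft] e.
  have [_ _ is_] := Hf s hs; have [_ _ it] := Hf t ht.
  by rewrite fs e in is_; rewrite ft in it; apply: (inserts_inj hx3 is_ it).
have TQ t : t \in [seq (f s).2 | s <- Sj] -> stopped_at (~~ p) t.
  by move=> /mapP [s /SjP [hs _] ->]; have [_ [_ h1 h2 h3] _] := Hf s hs.
have : \sum_(t <- [seq (f s).2 | s <- Sj]) weight t <= c.
  rewrite -lee_fin /c (fineK pE) -sumEFin.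
  have <- : (\sum_(s <- [seq (f s).2 | s <- Sj]) P (cyl s) =
     \sum_(s <- [seq (f s).2 | s <- Sj]) (weight s)%:E)%E.
    by apply: eq_big_seq => s /TQ /wE.
  exact: prob_event_ge.
rewrite big_map => sc; apply: le_trans (ler_wpM2l _ sc); last first.
  by rewrite exprn_ge0.
rewrite mulr_sumr big_seq [leRHS]big_seq; apply: ler_sum => s sS.
have [hs fs] := SjP s sS; have [f14 [w' _ _ _] /size_inserts sz] := Hf s hs.
have [ws _ _ _] := hs.
rewrite /weight ws w' sz exprD invfM mulrCA ler_peMr ?invr_ge0 ?exprn_ge0//.
by rewrite ler_pdivlMr ?exprn_gt0// mul1r ler_weXn2l// ler1n.
Qed.

Lemma event_gt0 : (0 < k)%N -> exists p, (0 < P (event (stopped_at p)))%E.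
Proof.
move=> k0; have [p [s [w h xs sp]]] := stopped_walk_exists rho hr hx hx3 k0.
have Qs : stopped_at p s by [].
exists p; apply: (@lt_le_trans _ _ (P (cyl s))).
  rewrite prob_cyl ?(halts_nonbdry h)// /weight w lte_fin invr_gt0.
  by rewrite exprn_gt0.
apply: le_measure; rewrite ?inE; [exact: measurable_cyl|exact: measurable_event|].
by move=> v vs; exists s.
Qed.

(** The property [Q] is kept general to serve both parities. *)
Lemma event_traj (Q : (nat -> Z2) -> nat -> Prop) :
  (forall y y' n, (forall i, (i <= n)%N -> y i = y' i) -> Q y n -> Q y' n) ->
  [set w | exists n, Q (Y ^~ w) n] = event [set s | Q (traj s) (size s)].
Proof.
move=> Qext; apply/seteqP; split=> [w [n Qn]|w [s Qs ws]]; last first.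
  by exists (size s); apply: Qext Qs => i /ws ->.
exists (mkseq (fun i => Y i.+1 w) n) => /=; last first.
  move=> i; rewrite size_mkseq /traj; case: i => [|i] ni /=.
    by rewrite (HV_start hY).
  by rewrite nth_mkseq.
rewrite size_mkseq; apply: Qext Qn => -[|i] ni; first by rewrite (HV_start hY).
by rewrite /traj /= nth_mkseq.
Qed.

Lemma is_tau_ext (y y' : nat -> Z2) n : (forall i, (i <= n)%N -> y i = y' i) ->
  is_tau r k y n -> is_tau r k y' n.
Proof.
move=> yy'; have stE m : (m <= n)%N -> stopped r k y m = stopped r k y' m.
  move=> mn; rewrite /stopped yy'//; congr ((_ == k) || _).
  apply: eq_in_count => i; rewrite mem_iota add1n ltnS => /andP[_ im].
  by rewrite !yy'// ?(leq_trans (leq_pred i))// (leq_trans im).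
by move=> [h1 h2]; split => [|m mn]; rewrite -stE// ?h2// ltnW.
Qed.

Lemma visits_ext (y y' : nat -> Z2) n : (forall i, (i <= n)%N -> y i = y' i) ->
  visits y x n = visits y' x n.
Proof.
move=> yy'; apply: eq_in_count => i; rewrite mem_iota add1n ltnS => /andP[_ im].
by rewrite yy'.
Qed.

Lemma p_evenE : p_even P r k Y x = fine (P (event (stopped_at false))).
Proof.
rewrite /p_even (@event_traj (fun y n => is_tau r k y n /\
  (0 < visits y x n)%N /\ ~~ odd (visits y x n))); last first.
  move=> y y' n yy' [h1 h2]; split; first exact: is_tau_ext h1.
  by rewrite -(visits_ext yy').
congr (fine (P (event _))); apply/seteqP; split => s; rewrite /= visits_traj.
  move=> [/is_tau_traj h [c0 /negPf c1]]; split => //.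
  by rewrite -has_pred1 has_count.
move=> [h xs c1]; split; first exact/is_tau_traj.
by rewrite c1 -has_count has_pred1.
Qed.

Lemma p_oddE : p_odd P r k Y x = fine (P (event (stopped_at true))).
Proof.
rewrite /p_odd (@event_traj (fun y n => is_tau r k y n /\
  odd (visits y x n))); last first.
  move=> y y' n yy' [h1 h2]; split; first exact: is_tau_ext h1.
  by rewrite -(visits_ext yy').
congr (fine (P (event _))); apply/seteqP; split => s; rewrite /= visits_traj.
  move=> [/is_tau_traj h c1]; split => //.
  by rewrite -has_pred1 has_count; case: count c1.
by move=> [h xs c1]; split; first exact/is_tau_traj.
Qed.

End Probability.

Lemma ratio_bounds (R : realFieldType) (a b c C : R) : 0 < c -> c <= C ->
  a <= c * b -> b <= c * a -> 0 < a \/ 0 < b ->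
  1 / C <= a / b /\ a / b <= C.
Proof.
move=> c0 cC ab ba ab0.
have b0 : 0 < b by case: ab0 => // a0; rewrite -(pmulr_rgt0 _ c0) (lt_le_trans a0).
have a0 : 0 < a by rewrite -(pmulr_rgt0 _ c0) (lt_le_trans b0).
have C0 : 0 < C by apply: lt_le_trans cC.
split; last by rewrite ler_pdivrMr// (le_trans ab)// ler_wpM2r// ltW.
rewrite ler_pdivlMr// mulrAC ler_pdivrMr// mul1r mulrC.
by rewrite (le_trans ba)// ler_wpM2r// ltW.
Qed.

(* For k = 0 the walk is stopped at time 0 and the ratio is 0 / 0. *)
Theorem lemma7p3 (R : realType) (k : nat) (r : R) (x : Z2) (rho : config)
  (d : measure_display) (Omega : measurableType d) (P : probability Omega R)
  (Y : nat -> Omega -> Z2) (zeta : nat -> Omega -> config)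
  (hr : 6 <= r) (hx : in_ball (r - 3) x) (hx3 : ~~ in_ball (3 : R) x)
  (hY : HV_walk P r rho Y zeta) :
  (k = 0%N -> p_even P r k Y x = 0 /\ p_odd P r k Y x = 0) /\
  ((0 < k)%N ->
     1 / (58 * 2 ^+ 58) <= p_even P r k Y x / p_odd P r k Y x /\
     p_even P r k Y x / p_odd P r k Y x <= 58 * 2 ^+ 58).
Proof.
rewrite (p_evenE k x hY) (p_oddE k x hY).
have ev p : P (event Y (stopped_at k r x p)) =
    (fine (P (event Y (stopped_at k r x p))))%:E.
  by rewrite fineK// fin_num_measure//; exact: (measurable_event hY).
split=> [k0|k0].
  suff e p : event Y (stopped_at k r x p) = set0 by rewrite !e measure0.
  apply/seteqP; split => // w [s [[_ hs] xs _] _].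
  case: s hs xs => // z s /(_ 0%N isT); rewrite /stop take0 k0.
  by [].
apply: (@ratio_bounds _ _ _ (15 * 2 ^+ 14)).
- by rewrite mulr_gt0// exprn_gt0.
- by rewrite ler_pM// ?ler_nat// ler_weXn2l// ler1n.
- by rewrite -lee_fin EFinM -!ev; exact: (parity_le k hr hx hx3 hY false).
- by rewrite -lee_fin EFinM -!ev; exact: (parity_le k hr hx hx3 hY true).
- have [[]] := event_gt0 hr hx hx3 hY k0; rewrite ev lte_fin => ?; [right|left] => //.
Qed.
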